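(* Let $d\ge2$. For each $\alpha>0$ there exists $p'(\alpha)\in(p_c(d),1)$ such that for every $p\in(p'(\alpha),1]$, \[ \limsup_{\|x\|_1\to+\infty,\ x\in\mathbb{Z}^d}\frac{\ln\mathbb{P}_p\big(0\leftrightarrow x,\ D(0,x)\ge(1+\alpha)\|x\|_1\big)}{\|x\|_1}<0. \]
   Context: Bernoulli bond percolation on $\mathbb{Z}^d$: $\mathbb{E}^d$ is the set of edges between points of $\mathbb{Z}^d$ at Euclidean distance $1$; $\mathbb{P}_p=(p\delta_1+(1-p)\delta_0)^{\otimes\mathbb{E}^d}$ on $\{0,1\}^{\mathbb{E}^d}$, an edge $e$ being open if $\omega(e)=1$. $p_c(d)$ is the critical probability of bond percolation on $\mathbb{Z}^d$. A path is a sequence of successive nearest neighbours; its length is its number of edges; it is open if all its edges are open. $x\leftrightarrow y$ means that $x$ and $y$ are joined by an open path. The chemical distance $D(x,y)$ is the minimal length of an open path from $x$ to $y$ ($+\infty$ if none). $\|x\|_1=\sum_i|x_i|$. *)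

(* Defs.v *)
From HB Require Import structures.
From mathcomp Require Import all_boot all_order all_algebra.
From mathcomp Require Import all_classical all_reals all_analysis.
Set Implicit Arguments. Unset Strict Implicit. Unset Printing Implicit Defensive.
Import Order.TTheory GRing.Theory Num.Theory.
Local Open Scope classical_set_scope.
Local Open Scope ring_scope.

Definition vertex (d : nat) := {ffun 'I_d -> int}.

Definition origin (d : nat) : vertex d := [ffun _ => 0].

Definition shift (d : nat) (x : vertex d) (i : 'I_d) (s : int) : vertex d :=
  [ffun j => x j + (if j == i then s else 0)].

Definition norm1 (d : nat) (x : vertex d) : nat := (\sum_(i < d) `|x i|)%N.

(* The edge set E^d: the pair (x, i) encodes the edge {x, x + e_i};
   this is a bijection onto the set of nearest-neighbour edges. *)
Definition edge (d : nat) := (vertex d * 'I_d)%type.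

(* Configurations omega in {0,1}^{E^d} (true = open). *)
Definition config (d : nat) := edge d -> bool.

Definition open_adj (d : nat) (om : config d) : rel (vertex d) :=
  fun y z => [exists i : 'I_d,
    ((z == shift y i 1) && om (y, i)) || ((y == shift z i 1) && om (z, i))].

Definition open_path (d : nat) (om : config d) (x y : vertex d) (n : nat) : Prop :=
  exists s : seq (vertex d), size s = n /\ path (open_adj om) x s /\ last x s = y.

Definition joined (d : nat) (om : config d) (x y : vertex d) : Prop :=
  exists n, open_path om x y n.

(* chemical distance D(x,y) (+oo if no open path) *)
Definition chem_dist (R : realType) (d : nat) (om : config d) (x y : vertex d)
  : \bar R := ereal_inf [set (n%:R)%:E | n in [set n | open_path om x y n]].

Definition percolates (d : nat) (om : config d) : Prop :=
  ~ finite_set [set y | joined om (origin d) y].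

(* (P, om) realises Bernoulli bond percolation P_p on Z^d: om : T -> {0,1}^{E^d}
   has measurable coordinates, and its finite-dimensional distributions are those
   of the product measure (p delta_1 + (1-p) delta_0)^{\otimes E^d}.
   (These determine the law of om, i.e. om is distributed as P_p.) *)
Definition bernoulli_bond (R : realType) (d : nat) (p : R)
  (d0 : measure_display) (T : measurableType d0) (P : probability T R)
  (om : T -> config d) : Prop :=
  (forall e : edge d, measurable [set t | om t e]) /\
  (forall (F : seq (edge d)) (a : edge d -> bool), uniq F ->
     P [set t | forall e, e \in F -> om t e = a e]
     = (\prod_(e <- F) (if a e then p else 1 - p))%:E).

Definition no_percolation (R : realType) (d : nat) (p : R) : Prop :=
  forall (d0 : measure_display) (T : measurableType d0) (P : probability T R)
    (om : T -> config d),
    bernoulli_bond p P om -> P [set t | percolates (om t)] = 0%E.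

Definition p_c (R : realType) (d : nat) : R :=
  sup [set p : R | 0 <= p <= 1 /\ no_percolation d p].

(* Main.v *)
Require Import Defs.
From HB Require Import structures.
From mathcomp Require Import all_boot all_order all_algebra.
From mathcomp Require Import all_classical all_reals all_analysis.
From mathcomp Require Import zify ring lra.
Set Implicit Arguments. Unset Strict Implicit. Unset Printing Implicit Defensive.
Import Order.TTheory GRing.Theory Num.Theory.
Local Open Scope classical_set_scope.
Local Open Scope ring_scope.

(** Call two edges close when their base points are at sup-distance at most 1, and
    let [K] be a set of closed edges containing every closed edge of a geodesic from
    [0] to [x] and every closed edge close to [K].  If [0] and [x] are joined by a
    path avoiding [K], they are joined by an open path made of edges of the geodesic
    and of edges close to [K].  Indeed, if [A] is the set of vertices reached from [0]
    by such paths, the edges of [K] in the boundary of [A] form a mod 2 cocycle, hence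
    a coboundary [d psi]; [psi] takes the same value at [0] and [x] because of the path
    avoiding [K], and different values because of the geodesic.

    So [D(0,x) <= |x| + C |K|].  A breadth-first exploration of the closed edges,
    encoded by bit masks, shows that the event that [K] cannot be chosen with fewer
    than [m] edges has probability at most [2^|x| (2^B (1 - p))^m], and [m] is taken
    to be a small multiple of [|x|].

    The bound [p_c < 1] uses the same detour argument: the segment from [0] to [n e_1]
    is compared with the other three sides of a square, which avoid [K] unless the
    closed cluster of some edge of the segment is at least as large as its distance to
    the nearer end point. *)

Local Notation shift := Defs.shift.

(** * Cochains and detours *)

Section Cochains.
Variable d : nat.
Implicit Types (v x y : vertex d) (i j : 'I_d) (f : edge d -> bool).

Definition head_of (e : edge d) : vertex d := shift e.1 e.2 1.

Definition coboundary (phi : vertex d -> bool) (e : edge d) : bool :=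
  phi e.1 (+) phi (head_of e).

(** The cocycle condition mod 2 for the 1-cochain [f]: both routes across a square have the same
    sum. *)
Definition even_on_squares f : Prop := forall v i j, i != j ->
  f (v, i) (+) f (shift v i 1, j) = f (v, j) (+) f (shift v j 1, i).

Lemma shiftC v i j s t : shift (shift v i s) j t = shift (shift v j t) i s.
Proof. by apply/ffunP => k; rewrite !ffunE -!addrA [X in _ + X]addrC. Qed.

Lemma shiftD v i s t : shift (shift v i s) i t = shift v i (s + t).
Proof. by apply/ffunP => k; rewrite !ffunE -addrA; case: ifP; rewrite ?addr0. Qed.

Lemma shift0 v i : shift v i 0 = v.
Proof. by apply/ffunP => k; rewrite !ffunE; case: ifP; rewrite addr0. Qed.

Lemma coboundary_even phi : even_on_squares (coboundary phi).
Proof.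
move=> v i j _; rewrite /coboundary /head_of /= (shiftC v i j).
by case: (phi v); case: (phi _); case: (phi _); case: (phi _).
Qed.

Definition integral_step (g : int -> bool) (s : int) : bool :=
  match s with
  | Posz n => \big[addb/false]_(k < n) g k
  | Negz n => \big[addb/false]_(k < n.+1) g (Negz k)
  end.

Lemma integral_stepP g s : integral_step g s (+) integral_step g (s + 1) = g s.
Proof.
case: s => [n|[|n]].
- by rewrite -PoszD addn1 /= big_ord_recr /= addbA addbb.
- by rewrite /= big_ord_recr !big_ord0 /= addbF.
- have -> : Negz n.+1 + 1 = Negz n by lia.
  by rewrite /= [in X in X (+) _]big_ord_recr /= addbC addbA addbb.
Qed.

Definition setc v i (s : int) : vertex d := [ffun k => if k == i then s else v k].

(** Integrate [f] in direction [k] from the hyperplane where that coordinate is 0. For [i < k], [f]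
    vanishes in direction [i], so the square condition makes [f (_, k)], hence its primitive,
    invariant under shifts in direction [i]. *)
Lemma poincare_step f (k : 'I_d) : even_on_squares f ->
    (forall v i, (i < k)%N -> f (v, i) = false) ->
  exists psi, forall v i, (i <= k)%N -> coboundary psi (v, i) = f (v, i).
Proof.
move=> fsq f0.
exists (fun v => integral_step (fun s => f (setc v k s, k)) (v k)) => v i.
rewrite /coboundary /head_of /= leq_eqVlt => /orP[/eqP/val_inj -> | ltik].
  have -> : shift v k 1 k = v k + 1 by rewrite ffunE eqxx.
  rewrite (_ : (fun s => f (setc (shift v k 1) k s, k)) = fun s => f (setc v k s, k)).
    by rewrite integral_stepP; congr (f (_, _)); apply/ffunP => j; rewrite ffunE; case: eqP => [->|].
  apply/funext => s; congr (f (_, _)); apply/ffunP => j; rewrite !ffunE.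
  by case: eqP => // _; rewrite addr0.
have neki : i != k by rewrite neq_ltn ltik.
have -> : shift v i 1 k = v k by rewrite ffunE eq_sym (negbTE neki) addr0.
rewrite (_ : (fun s => f (setc (shift v i 1) k s, k)) = fun s => f (setc v k s, k)).
  by rewrite addbb f0.
apply/funext => s.
have -> : setc (shift v i 1) k s = shift (setc v k s) i 1.
  apply/ffunP => j; rewrite !ffunE; case: (eqVneq j k) => // ->.
  by rewrite eq_sym (negbTE neki) addr0.
have := fsq (setc v k s) i k neki.
by rewrite (f0 _ i) // (f0 (shift _ _ _) i) // addFb addbF.
Qed.

(** Directions are treated one at a time: once the coboundary found for the first [k] is subtracted,
    [poincare_step] integrates direction [k] without spoiling the earlier ones. *)
Lemma poincare f : even_on_squares f ->
  exists phi, forall e, coboundary phi e = f e.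
Proof.
move=> fsq.
suff /(_ d (leqnn d)) [phi phiP] : forall k, (k <= d)%N ->
    exists phi, forall v i, (i < k)%N -> coboundary phi (v, i) = f (v, i).
  by exists phi => -[v i]; apply: phiP.
elim=> [_|k IHk ltkd]; first by exists (fun=> false).
have [phi phiP] := IHk (ltnW ltkd).
pose g e := f e (+) coboundary phi e.
have gsq : even_on_squares g.
  move=> v i j nij; have := fsq v i j nij; have := coboundary_even phi v nij.
  rewrite /g; do 4![case: (f _)]; do 4![case: (coboundary _ _)] => //.
have [|psi psiP] := @poincare_step g (Ordinal ltkd) gsq.
  by move=> v i ltik; rewrite /g phiP // addbb.
exists (fun v => phi v (+) psi v) => v i ltik.
have := psiP v i ltik; rewrite /g /coboundary /=.
by case: (phi _); case: (phi _); case: (psi _); case: (psi _); case: (f _).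
Qed.

Lemma joined_refl (om : config d) x : joined om x x.
Proof. by exists 0%N, [::]. Qed.

Lemma joined_step (om : config d) x y z :
  joined om x y -> open_adj om y z -> joined om x z.
Proof.
move=> [n [s [sn [ps ls]]]] yz; exists n.+1, (rcons s z).
by rewrite size_rcons sn rcons_path ps ls last_rcons.
Qed.

Lemma open_adj_fwd (om : config d) e : om e -> open_adj om e.1 (head_of e).
Proof. by case: e => v i /= oe; apply/existsP; exists i; rewrite eqxx oe. Qed.

Lemma open_adj_bwd (om : config d) e : om e -> open_adj om (head_of e) e.1.
Proof. by case: e => v i /= oe; apply/existsP; exists i; rewrite eqxx oe orbT. Qed.

Lemma open_adjP (om : config d) y z : open_adj om y z ->
  exists2 e, om e & (y = e.1 /\ z = head_of e) \/ (z = e.1 /\ y = head_of e).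
Proof.
move=> /existsP[i /orP[/andP[/eqP zE oe]|/andP[/eqP yE oe]]].
  by exists (y, i) => //; left.
by exists (z, i) => //; right.
Qed.

Lemma joined_const (om : config d) (phi : vertex d -> bool) x y :
  (forall e, om e -> coboundary phi e = false) -> joined om x y -> phi x = phi y.
Proof.
move=> phi0 [n [s [_ [ps ls]]]]; elim: s x ps ls => [x _ <-//|z s IHs x /= /andP[xz ps] ls].
rewrite -(IHs z ps ls); have [e /phi0] := open_adjP xz.
by rewrite /coboundary => /negbT; rewrite negb_add => /eqP h [[-> ->]|[-> ->]].
Qed.

Definition close_edges (e e' : edge d) : bool :=
  [forall k, `|e'.1 k - e.1 k| <= 1].

(* Splitting the edge boundary of a set [A] along a family [K] of closed edges
   which contains every closed edge close to it gives a cocycle. *)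
Lemma detour (om K gam : config d) x y :
    (forall e, K e -> ~~ om e) ->
    (forall e e', K e -> close_edges e e' -> ~~ om e' -> K e') ->
    (forall e, gam e -> ~~ om e -> K e) ->
    joined gam x y -> joined (fun e => ~~ K e) x y ->
  joined (fun e => om e && (gam e || `[< exists2 e', K e' & close_edges e' e >])) x y.
Proof.
move=> Kcl Kadj gamK jg jK; set om' := (X in joined X x y).
pose A z := `[< joined om' x z >].
have A_om' e : om' e -> coboundary A e = false.
  move=> oe; apply/negbTE; rewrite /coboundary negb_add; apply/eqP.
  apply: asbool_equiv_eq; split => h; apply: joined_step h _.
    exact: open_adj_fwd.
  exact: open_adj_bwd.
(* An open edge close to [K] belongs to [om'], so it does not leave [A]; a boundary edge of [A]
   close to [K] is therefore closed. *)
have near e e' : K e -> close_edges e e' -> coboundary A e' -> K e'.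
  move=> Ke ee' Ae'; apply: (Kadj _ _ Ke ee'); apply: (contraL _ Ae') => oe'.
  by rewrite A_om' // /om' oe'; apply/orP; right; apply/asboolP; exists e.
pose f e := K e && coboundary A e.
have fsq : even_on_squares f.
  move=> v i j nij.
  (* The sides of a square are pairwise close: if one is in [K], [f] agrees with the coboundary of
     [A] on all four; otherwise [f] vanishes on them. *)
  pose sq := [:: (v, i); (shift v i 1, j); (v, j); (shift v j 1, i)].
  have sqc e e' : e \in sq -> e' \in sq -> close_edges e e'.
    by rewrite !inE => /or4P[] /eqP -> /or4P[] /eqP ->; apply/forallP => k /=;
       rewrite ?ffunE; do 2?case: ifP => ?; lia.
  have [/hasP[e esq Ke]|/hasPn noK] := boolP (has K sq).
    have fE e' : e' \in sq -> f e' = coboundary A e'.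
      move=> e'sq; rewrite /f; case cA: (coboundary A e'); last by rewrite andbF.
      by rewrite (near e e') // sqc.
    by rewrite !fE ?inE ?eqxx ?orbT //; apply: coboundary_even.
  by rewrite /f !(negbTE (noK _ _)) ?inE ?eqxx ?orbT.
have [psi psiP] := poincare fsq.
have psi_xy : psi x = psi y.
  by apply: joined_const jK => e nK; rewrite psiP /f (negbTE nK).
(* Along [gam] the two coboundaries agree: on [K] by the choice of [psi]; off [K] the edge is open,
   hence in [om'], and both vanish. *)
have : A x (+) psi x = A y (+) psi y.
  apply: (@joined_const gam (fun z => A z (+) psi z)) jg => e ge.
  have : coboundary A e = coboundary psi e.
    rewrite psiP /f; case Ke: (K e) => //=; apply: A_om'.
    rewrite /om' ge andbT; apply: contraFT Ke => /gamK; exact.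
  rewrite /coboundary.
  by case: (A _); case: (A _); case: (psi _); case: (psi _).
rewrite psi_xy => /addIb Axy.
by apply/asboolP; rewrite -[asbool _]/(A y) -Axy; apply/asboolP/joined_refl.
Qed.

Lemma open_path_sub (om om' : config d) x y n :
  (forall e, om e -> om' e) -> open_path om x y n -> open_path om' x y n.
Proof.
move=> sub [s [sn [ps ls]]]; exists s; split=> //; split=> //.
apply: sub_path ps => u v /existsP[i h]; apply/existsP; exists i.
by case/orP: h => /andP[-> /sub ->]; rewrite ?orbT.
Qed.

Lemma joined_sub (om om' : config d) x y :
  (forall e, om e -> om' e) -> joined om x y -> joined om' x y.
Proof. by move=> sub [n /(open_path_sub sub) pn]; exists n. Qed.

Lemma joined_trans (om : config d) x y z :
  joined om x y -> joined om y z -> joined om x z.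
Proof.
move=> [n [s [sn [ps ls]]]] [m [s' [sm [ps' ls']]]]; exists (n + m)%N, (s ++ s').
by rewrite size_cat sn sm cat_path ps ls ps' last_cat ls ls'.
Qed.

Lemma open_adj_sym (om : config d) y z : open_adj om y z = open_adj om z y.
Proof. by apply/existsP/existsP => -[i h]; exists i; rewrite orbC. Qed.

Lemma joined_sym (om : config d) x y : joined om x y -> joined om y x.
Proof.
move=> [n [s [_ [ps <-]]]]; elim: s x ps => [x _|z s IHs x /= /andP[xz /IHs ps]].
  exact: joined_refl.
by apply: joined_step ps _; rewrite open_adj_sym.
Qed.

(** After loop erasure the vertices of the path are distinct members of [V], and they outnumber its
    edges by one. *)
Lemma joined_short (om : config d) (V : seq (vertex d)) x y : x \in V ->
    (forall e, om e -> e.1 \in V /\ head_of e \in V) -> joined om x y ->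
  exists2 n, (n < size V)%N & open_path om x y n.
Proof.
move=> xV omV [n [s [_ [ps ls]]]].
case/shortenP: ps ls => s' ps' us' _ ls; exists (size s'); last by exists s'.
apply: (@uniq_leq_size _ (x :: s') V us') => z; rewrite inE => /orP[/eqP->//|].
elim: s' x ps' {xV us' ls} => //= w s' IHs x /andP[/open_adjP[e /omV[V1 V2]]].
move=> h /IHs IH; rewrite inE => /orP[/eqP-> {IH}|//].
by case: h => [[_ ->]|[-> _]].
Qed.

Lemma norm1_eq0 x : norm1 x = 0%N -> x = origin d.
Proof.
move=> /eqP; rewrite sum_nat_eq0 => /forallP h; apply/ffunP => i; rewrite ffunE.
by have := h i; rewrite /= absz_eq0 => /eqP.
Qed.

Lemma norm1_shift x i s : (norm1 x + `|(x i + s)%R| = norm1 (shift x i s) + `|x i|)%N.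
Proof.
rewrite /norm1 (bigD1 i) //= [in RHS](bigD1 i) //= ffunE eqxx.
rewrite [in RHS](eq_bigr (fun k => `|x k|%N)); first by rewrite addnC [X in (_ + X)%N = _]addnC addnA.
by move=> k /negbTE nk; rewrite ffunE nk addr0.
Qed.

Lemma geodesic x : exists (E : seq (edge d)) (V : seq (vertex d)),
  [/\ size E = norm1 x, size V = (norm1 x).+1, origin d \in V /\ x \in V,
    (forall e, e \in E -> e.1 \in V /\ head_of e \in V)
    & joined (fun e => e \in E) (origin d) x].
Proof.
move En : (norm1 x) => n; elim: n x En => [|n IHn] x En.
  exists [::], [:: x]; rewrite (norm1_eq0 En) !mem_head.
  by split=> //; apply: joined_refl.
have [i xi] : exists i, x i != 0.
  apply/existsP; apply: contra_eqT En => /existsPn h.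
  by rewrite /norm1 big1 // => i _; have /negPn/eqP -> := h i.
pose y := shift x i (if 0 < x i then -1 else 1).
pose e : edge d := if 0 < x i then (y, i) else (x, i).
have ny : norm1 y = n.
  by have := norm1_shift x i (if 0 < x i then -1 else 1); rewrite -/y; case: ifP; lia.
have e_ends : (y = e.1 /\ x = head_of e) \/ (x = e.1 /\ y = head_of e).
  rewrite /e /y /head_of; case: ifP => _ /=; [left|by right].
  by rewrite shiftD addNr shift0.
have [E [V [sE sV [oV yV] EV jE]]] := IHn y ny.
exists (e :: E), (x :: V); rewrite /= sE sV !inE oV eqxx orbT; split=> //.
  move=> e'; rewrite inE => /orP[/eqP->|/EV [V1 V2]]; last by rewrite !inE V1 V2 !orbT.
  by case: e_ends => -[<- <-]; rewrite !inE ?yV ?eqxx ?orbT.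
apply: (@joined_step _ _ y).
  by apply: joined_sub jE => e' e'E; rewrite inE e'E orbT.
case: e_ends => -[-> ->]; [apply: open_adj_fwd|apply: open_adj_bwd]; exact: mem_head.
Qed.

End Cochains.

(** * Exploration of closed edges *)

Section Exploration.
Variable d : nat.
Implicit Types (e : edge d) (om : config d) (S L K : seq (edge d)).

(** The number of edges close to a given one: [3 ^ d] base points with [d] directions each. *)
Definition branching : nat := (3 ^ d * d)%N.

Definition nbrs e : seq (edge d) :=
  [seq ([ffun k => e.1 k + ((u k)%:Z - 1)], j)
  | u : {ffun 'I_d -> 'I_3} <- enum {ffun 'I_d -> 'I_3}, j : 'I_d <- enum 'I_d].

Lemma size_nbrs e : size (nbrs e) = branching.
Proof. by rewrite size_allpairs -!cardE card_ffun !card_ord. Qed.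

Lemma mem_nbrs e e' : (e' \in nbrs e) = close_edges e e'.
Proof.
apply/allpairsP/forallP => [[[u j] [_ _ ->]] k /=|close].
  by rewrite ffunE addrAC subrr add0r; case: (u k) => q lq /=; lia.
exists ([ffun k => inord `|(e'.1 k - e.1 k + 1)%R|%N], e'.2).
rewrite !mem_enum; split=> //=; case: e' close => v j /= close; congr pair.
apply/ffunP => k; rewrite !ffunE inordK; move: (close k); move: (v k) (e.1 k) => a b; lia.
Qed.

(** The masks stand in for the configuration: each says which neighbours of the first queued edge
    are appended. The outcome depends on them alone, so outcomes can be counted. *)
Fixpoint explore (cs : seq bitseq) (fin queue : seq (edge d)) : seq (edge d) :=
  match cs, queue with
  | c :: cs', e :: q => explore cs' (rcons fin e) (q ++ mask c (nbrs e))
  | _, _ => fin ++ queue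
  end.

Definition saturated om K : Prop :=
  forall e e', e \in K -> e' \in nbrs e -> ~~ om e' -> e' \in K.

Definition closed_list om K : bool := uniq K && all (fun e => ~~ om e) K.

Lemma mask_undup_filter (T : eqType) (a : pred T) (s : seq T) :
  exists2 m : bitseq, size m = size s & mask m s = undup [seq x <- s | a x].
Proof.
have /subseqP[m sm ->] : subseq (undup [seq x <- s | a x]) s.
  exact: subseq_trans (undup_subseq _) (filter_subseq _ _).
by exists m.
Qed.

Lemma lift_tuples n (cs : seq bitseq) : {in cs, forall c, size c = n} ->
  exists ts : seq (n.-tuple bool), map val ts = cs.
Proof.
elim: cs => [|c cs IHcs] sz; first by exists [::].
have [|ts <-] := IHcs; first by move=> c' c'cs; apply: sz; rewrite inE c'cs orbT.
have sc : size c == n by rewrite sz ?mem_head.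
by exists (Tuple sc :: ts).
Qed.

(* [h] is a 1-Lipschitz height, which controls how far the explored set extends. *)
Lemma explore_dichotomy om (h : edge d -> nat) m fin queue :
    (forall e e', e' \in nbrs e -> (h e' <= (h e).+1)%N) ->
    closed_list om (fin ++ queue) ->
    (forall e e', e \in fin -> e' \in nbrs e -> ~~ om e' -> e' \in fin ++ queue) ->
    {in fin ++ queue, forall e, (h e < size (fin ++ queue))%N} ->
  (exists cs : seq bitseq, [/\ size cs = m, {in cs, forall c, size c = branching},
     closed_list om (explore cs fin queue)
     & (m + size fin <= size (explore cs fin queue))%N]) \/
  (exists K, [/\ closed_list om K, saturated om K, {subset fin ++ queue <= K},
     (size K < m + size fin)%N & {in K, forall e, (h e < size K)%N}]).
Proof.
move=> hlip; elim: m fin queue => [|m IHm] fin queue cl sat hb.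
  left; exists [::]; rewrite (_ : explore [::] fin queue = fin ++ queue).
    by split=> //; rewrite size_cat leq_addr.
  by case: (queue).
case: queue cl sat hb => [|e q] cl sat hb.
  (* The queue is empty, so every neighbour of a processed edge has been examined. *)
  right; exists fin; rewrite cats0 in cl sat hb *; split=> //.
  by rewrite addSn ltnS leq_addl.
(* The mask selects the closed neighbours not met before. *)
have [c sc cE] := mask_undup_filter
  (fun e' => ~~ om e' && (e' \notin fin ++ e :: q)) (nbrs e).
have catE : rcons fin e ++ (q ++ mask c (nbrs e)) = (fin ++ e :: q) ++ mask c (nbrs e).
  by rewrite catA cat_rcons -catA.
have mem_new e' : (e' \in mask c (nbrs e)) =
    [&& ~~ om e', e' \notin fin ++ e :: q & e' \in nbrs e].
  by rewrite cE mem_undup mem_filter andbA.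
have [| | |[cs [scs bcs clcs lecs]]|[K [clK satK subK ltK hK]]] :=
  IHm (rcons fin e) (q ++ mask c (nbrs e)).
- rewrite catE; case/andP: cl => ucl acl; apply/andP; split.
    rewrite cat_uniq ucl [in X in _ && (_ && X)]cE undup_uniq andbT /=.
    by apply/hasPn => e'; rewrite mem_new => /and3P[].
  by rewrite all_cat acl /=; apply/allP => e'; rewrite mem_new => /and3P[].
- move=> e1 e2; rewrite mem_rcons inE catE mem_cat => /orP[/eqP->|e1f] e2n ne2.
    by case: (boolP (e2 \in fin ++ e :: q)) => //= nin; rewrite mem_new ne2 nin.
  by rewrite (sat e1 e2).
- rewrite catE => e'; rewrite mem_cat size_cat => /orP[/hb lt|new].
    exact: leq_trans lt (leq_addr _ _).
  (* A new edge is at most one higher than [e], while the list has grown by at least one edge. *)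
  have := new; rewrite mem_new => /and3P[_ _ /hlip le].
  have lt : (h e < size (fin ++ e :: q))%N by apply: hb; rewrite mem_cat mem_head orbT.
  have : (0 < size (mask c (nbrs e)))%N by case: (mask _ _) new.
  lia.
- left; exists (c :: cs) => /=; rewrite scs; split=> //.
    by move=> c'; rewrite inE => /orP[/eqP->|/bcs //]; rewrite sc size_nbrs.
  by rewrite size_rcons addnS in lecs; rewrite addSn.
- right; exists K; split=> //.
    by move=> e' e'in; apply: subK; rewrite catE mem_cat e'in.
  by rewrite size_rcons addnS in ltK; rewrite addSn.
Qed.

Definition code S m : finType :=
  ((size S).-tuple bool * m.-tuple (branching.-tuple bool))%type.

Definition decode S m (c : code S m) : seq (edge d) :=
  explore (map val c.2) [::] (mask c.1 S).

(** Quantifying over all codes gives a finite union of events about fixed lists of edges, ready for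
    a union bound. *)
Definition large_exploration om S m : Prop :=
  exists c : code S m, (m <= size (decode c))%N /\ closed_list om (decode c).

(** Explore from the closed edges of [S] with [m] masks: if all are used, they form the code of a
    large exploration; otherwise the queue has emptied and the explored edges form [K]. *)
Lemma exploration om S m (h : edge d -> nat) :
    (forall e e', e' \in nbrs e -> (h e' <= (h e).+1)%N) ->
    {in S, forall e, h e = 0%N} -> ~ large_exploration om S m ->
  exists K, [/\ closed_list om K, saturated om K,
    {in S, forall e, ~~ om e -> e \in K}, (size K < m)%N
    & {in K, forall e, (h e < size K)%N}].
Proof.
move=> hlip hS nlarge.
have [w sw wE] := mask_undup_filter (fun e => ~~ om e) S.
have [| | |[cs [scs bcs clcs lecs]]|[K [clK satK subK ltK hK]]] :=
  @explore_dichotomy om h m [::] (mask w S) hlip.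
- rewrite cat0s wE /closed_list undup_uniq /=.
  by apply/allP => e; rewrite mem_undup mem_filter => /andP[].
- by [].
- rewrite cat0s => e eS; rewrite hS; first by case: (mask _ _) eS.
  by have := eS; rewrite wE mem_undup mem_filter => /andP[].
- exfalso; apply: nlarge.
  have [ts tsE] := lift_tuples bcs.
  have sts : size ts == m by rewrite -scs -tsE size_map.
  have sw' : size w == size S by rewrite sw.
  by exists (Tuple sw', Tuple sts); rewrite /decode /= tsE; rewrite addn0 in lecs.
- rewrite addn0 in ltK; exists K; split=> // e eS ne; apply: subK.
  by rewrite cat0s wE mem_undup mem_filter ne.
Qed.

Lemma card_code S m :
  #|code S m| = (2 ^ size S * (2 ^ branching) ^ m)%N.
Proof. by rewrite card_prod !card_tuple card_bool. Qed.

End Exploration.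

(** * Events and their probabilities *)

Section Percolation.
Variables (R : realType) (d : nat) (p : R) (d0 : measure_display)
  (T : measurableType d0) (P : probability T R) (om : T -> config d).
Hypothesis omP : bernoulli_bond p P om.

Lemma measure_bigsetU_le (I : Type) (r : seq I) (A : I -> set T) :
  (forall i, measurable (A i)) ->
  (P (\big[setU/set0]_(i <- r) A i) <= \sum_(i <- r) P (A i))%E.
Proof.
move=> mA; elim: r => [|i r IHr]; first by rewrite !big_nil measure0.
rewrite !big_cons; apply: le_trans (measureU2 _ _ _) _ => //.
  exact: bigsetU_measurable.
exact: leeD2l.
Qed.

Lemma measurable_open_edge e : measurable [set t | om t e].
Proof. by have [] := omP. Qed.

Lemma measurable_closed_list L : measurable [set t | closed_list (om t) L].
Proof.
rewrite /closed_list; case: (uniq L) => /=; last first.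
  by rewrite (_ : [set _ | _] = set0) //; apply/seteqP; split.
rewrite (_ : [set _ | _] = \big[setI/setT]_(e <- L) ~` [set t | om t e]).
  apply: bigsetI_measurable => e _; apply: measurableC; exact: measurable_open_edge.
elim: L => [|e L IHL]; first by rewrite big_nil; apply/seteqP; split.
rewrite big_cons -IHL; apply/seteqP; split=> t /=.
  by move=> /andP[/negP ? ?].
by move=> [/negP -> ->].
Qed.

Lemma prob_closed_list L : uniq L ->
  P [set t | closed_list (om t) L] = ((1 - p) ^+ size L)%:E.
Proof.
move=> uL; have [_ /(_ L (fun=> false) uL)] := omP.
rewrite big_const_seq count_predT iter_mulr_1 => <-.
congr (P _); apply/seteqP; split=> t /=; rewrite /closed_list uL.
  by move=> /allP h e /h /negbTE.
by move=> h; apply/allP => e /h ->.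
Qed.

Definition code_event (S : seq (edge d)) m (c : code S m) : set T :=
  if (m <= size (decode c))%N
  then [set t | closed_list (om t) (decode c)] else set0.

Lemma large_explorationE S m : [set t | large_exploration (om t) S m] =
  \big[setU/set0]_(c <- enum (code S m)) code_event c.
Proof.
rewrite -bigcup_seq; apply/seteqP; split=> t /=.
  by move=> [c [mc cl]]; exists c; rewrite /= ?mem_enum // /code_event mc.
by move=> [c _]; rewrite /code_event; case: ifP => // mc cl; exists c.
Qed.

Lemma measurable_code_event S m c : measurable (@code_event S m c).
Proof. by rewrite /code_event; case: ifP => // _; apply: measurable_closed_list. Qed.

Lemma measurable_large_exploration S m :
  measurable [set t | large_exploration (om t) S m].
Proof.
rewrite large_explorationE; apply: bigsetU_measurable => c _.
exact: measurable_code_event.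
Qed.

Hypothesis p01 : 0 <= p <= 1.

(** The powers of 2 count the codes, and each code contributes at most [(1 - p) ^+ m]. *)
Lemma prob_large_exploration S m :
  (P [set t | large_exploration (om t) S m] <=
   (2 ^+ size S * (2 ^+ branching d * (1 - p)) ^+ m)%:E)%E.
Proof.
have [p0 p1] := andP p01; have q0 : 0 <= 1 - p by lra.
rewrite large_explorationE; apply: le_trans (measure_bigsetU_le _ _) _.
  exact: measurable_code_event.
apply: (@le_trans _ _ (\sum_(c <- enum (code S m)) ((1 - p) ^+ m)%:E)%E).
  apply: lee_sum => c _; rewrite /code_event; case: ifP => mc; last first.
    by rewrite measure0 lee_fin exprn_ge0.
  have [u|nu] := boolP (uniq (decode c)); last first.
    rewrite (_ : [set t | _] = set0) ?measure0 ?lee_fin ?exprn_ge0 //.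
    by apply/seteqP; split=> // t /=; rewrite /closed_list (negbTE nu).
  rewrite prob_closed_list // lee_fin; apply: ler_wiXn2l => //; lra.
rewrite sumEFin lee_fin big_const_seq count_predT -cardE card_code iter_addr_0.
by rewrite exprMn mulrA -!natrX -natrM mulr_natl.
Qed.

(** * Measurability of connection and distance events *)

Lemma countable_count (U : countType) : countable [set: U].
Proof. by apply/countableP. Qed.

Lemma measurable_open_adj y z : measurable [set t | open_adj (om t) y z].
Proof.
rewrite (_ : [set _ | _] = \big[setU/set0]_(i <- enum 'I_d)
    ((if z == shift y i 1 then [set t | om t (y, i)] else set0) `|`
     (if y == shift z i 1 then [set t | om t (z, i)] else set0))).
  apply: bigsetU_measurable => i _; apply: measurableU; case: ifP => // _;
  exact: measurable_open_edge.
rewrite -bigcup_seq; apply/seteqP; split=> t /=.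
  move=> /existsP[i /orP[|] /andP[e o]]; exists i; rewrite /= ?mem_enum //.
    by left; rewrite e.
  by right; rewrite e.
by move=> [i _ [|]]; case: ifP => // e o; apply/existsP; exists i; rewrite e o ?orbT.
Qed.

Lemma measurable_path x s : measurable [set t | path (open_adj (om t)) x s].
Proof.
elim: s x => [|y s IHs] x /=.
  by rewrite (_ : [set _ | _] = setT) //; apply/seteqP; split.
rewrite (_ : [set _ | _] = [set t | open_adj (om t) x y] `&`
                           [set t | path (open_adj (om t)) y s]).
  by apply: measurableI => //; apply: measurable_open_adj.
by apply/seteqP; split=> t /= /andP.
Qed.

Lemma measurable_open_path x y n : measurable [set t | open_path (om t) x y n].
Proof.
rewrite (_ : [set _ | _] = \bigcup_(s : seq (vertex d))
    (if (size s == n) && (last x s == y)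
     then [set t | path (open_adj (om t)) x s] else set0)).
  apply: countable_bigcupT_measurable; first exact: countable_count.
  by move=> s; case: ifP => // _; apply: measurable_path.
apply/seteqP; split=> t /=.
  by move=> [s [sn [ps ls]]]; exists s; rewrite //= sn ls !eqxx.
by move=> [s _]; case: ifP => // /andP[/eqP ? /eqP ?] ?; exists s.
Qed.

Lemma measurable_joined x y : measurable [set t | joined (om t) x y].
Proof.
rewrite (_ : [set _ | _] = \bigcup_n [set t | open_path (om t) x y n]).
  by apply: bigcupT_measurable => n; apply: measurable_open_path.
by apply/seteqP; split=> t /= [n]; exists n.
Qed.

Lemma le_chem_distP (c : config d) x y (r : R) :
  (r%:E <= chem_dist R c x y)%E <-> forall n, open_path c x y n -> r <= n%:R.
Proof.
split=> [le n pn|le].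
  by rewrite -lee_fin; apply: le_trans le _; apply: ereal_inf_lbound; exists n.
by apply: le_ereal_inf_tmp => _ [n pn <-]; rewrite lee_fin; apply: le.
Qed.

Lemma measurable_le_chem_dist x y (r : R) :
  measurable [set t | (r%:E <= chem_dist R (om t) x y)%E].
Proof.
rewrite (_ : [set _ | _] = ~` \bigcup_n
  (if r <= n%:R then set0 else [set t | open_path (om t) x y n])).
  apply: measurableC; apply: bigcupT_measurable => n.
  by case: ifP => // _; apply: measurable_open_path.
apply/seteqP; split=> t /=.
  move=> /le_chem_distP le [n _]; case: ifP => // nle /le; rewrite nle //.
move=> h; apply/le_chem_distP => n pn; apply: contrapT => nle; apply: h.
by exists n => //; case: ifP.
Qed.

End Percolation.

(** * Decay of the chemical distance tail *)

Section Decay.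
Variable d : nat.

Lemma size_flatten_nbrs (K : seq (edge d)) :
  size (flatten (map (@nbrs d) K)) = (size K * branching d)%N.
Proof. by elim: K => //= e K IHK; rewrite size_cat size_nbrs IHK mulSn. Qed.

(** The detour round [K] visits only the [norm1 x + 1] vertices of the geodesic and the ends of at
    most [branching d] edges per edge of [K]. Since [size K <= m - 1], one multiple of
    [2 * branching d] is saved; it appears on the left. *)
Lemma short_open_path (x : vertex d) : exists2 E : seq (edge d), size E = norm1 x &
  forall (om : config d) m, joined om (origin d) x -> ~ large_exploration om E m ->
  exists2 n, (n + 2 * branching d <= norm1 x + 2 * branching d * m)%N
    & open_path om (origin d) x n.
Proof.
have [E [V [sE sV [oV _] EV jE]]] := geodesic x.
exists E => // om m jom nlarge.
have [K [/andP[_ /allP Kcl] Ksat EK ltK _]] :=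
  @exploration d om E m (fun=> 0%N) (fun _ _ _ => isT) (fun _ _ => erefl) nlarge.
have Kadj e e' : e \in K -> close_edges e e' -> ~~ om e' -> e' \in K.
  by rewrite -mem_nbrs; apply: Ksat.
have jK : joined (fun e => e \notin K) (origin d) x.
  by apply: joined_sub jom => e oe; apply: contraL oe => /Kcl.
have jd := @detour d om (fun e => e \in K) (fun e => e \in E) _ _ Kcl Kadj EK jE jK.
pose N := flatten (map (@nbrs d) K).
have [||n ltn pn] := joined_short _ _ jd (V := V ++ map fst N ++ map (@head_of d) N).
- by rewrite mem_cat oV.
- move=> e /andP[_ /orP[/EV[V1 V2]|/asboolP[e' e'K e'e]]].
    by rewrite !mem_cat V1 V2.
  have eN : e \in N by apply/flattenP; exists (nbrs e'); rewrite ?mem_nbrs ?map_f.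
  by rewrite !mem_cat !(map_f _ eN) !orbT.
exists n; last by apply: open_path_sub pn => e /andP[].
move: ltn; rewrite !size_cat !size_map size_flatten_nbrs sV; nia.
Qed.

(** With [m = norm1 x %/ k], a detour lengthens the geodesic by less than
    [2 * branching d * m <= alpha * norm1 x], so the event forces a large exploration from the
    geodesic. *)
Lemma chem_dist_decay (R : realType) (alpha p : R) (k : nat)
    (d0 : measure_display) (T : measurableType d0) (P : probability T R)
    (om : T -> config d) :
    (0 < d)%N -> (0 < k)%N -> (2 * branching d)%:R <= alpha * k%:R ->
    2 ^+ (branching d + 4 * k) * (1 - p) <= 1 -> 0 <= p <= 1 ->
    bernoulli_bond p P om ->
  forall x : vertex d, (k <= norm1 x)%N ->
  (P [set t | joined (om t) (origin d) x /\
        (((1 + alpha) * (norm1 x)%:R)%:E <= chem_dist R (om t) (origin d) x)%E]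
   <= (expR (- ln 2 * (norm1 x)%:R))%:E)%E.
Proof.
move=> d_gt0 k_gt0 le_k small p01 omP x le_kx.
have [E sE short] := short_open_path x.
pose n := norm1 x; pose m := (n %/ k)%N.
have b_gt0 : (0 < branching d)%N by rewrite muln_gt0 expn_gt0.
have mk : (m * k <= n < m.+1 * k)%N by rewrite leq_divM ltn_ceil.
have m_gt0 : (0 < m)%N by rewrite divn_gt0.
have p1 : 0 <= 1 - p by case/andP: p01; lra.
apply: (@le_trans _ _ (P [set t | large_exploration (om t) E m])).
  apply: le_measure; rewrite ?inE.
  - rewrite [X in measurable X]setIC; apply: measurableI.
      exact: measurable_le_chem_dist omP _ _ _.
    exact: measurable_joined omP _ _.
  - exact: measurable_large_exploration omP _ _.
  move=> t /= [jt /le_chem_distP le_t]; apply: contrapT => /(short _ _ jt)[l le_l /le_t].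
  apply/negP; rewrite -ltNge.
  have le1 : l%:R + (2 * branching d)%:R <= n%:R + (2 * branching d)%:R * m%:R :> R.
    by rewrite -natrM -!natrD ler_nat.
  have le2 : (2 * branching d)%:R * m%:R <= alpha * (k%:R * m%:R) :> R.
    by rewrite mulrA ler_wpM2r.
  have al_gt0 : 0 < alpha.
    rewrite -(pmulr_lgt0 _ (_ : 0 < k%:R)) ?ltr0n //; apply: lt_le_trans le_k.
    by rewrite ltr0n muln_gt0.
  have le3 : alpha * (k%:R * m%:R) <= alpha * n%:R.
    by rewrite ler_pM2l // -natrM ler_nat mulnC; case/andP: mk.
  have : 0 < (2 * branching d)%:R :> R by rewrite ltr0n muln_gt0.
  rewrite mulrDl mul1r; lra.
apply: le_trans (prob_large_exploration omP p01 _ _) _; rewrite lee_fin sE -/n.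
have -> : expR (- ln 2 * n%:R) = 2 ^- n :> R.
  by rewrite mulNr expRN expRM_natr lnK // posrE.
rewrite -[leRHS]div1r ler_pdivlMr ?exprn_gt0 // mulrAC -exprD.
have small' : 0 <= 2 ^+ branching d * (1 - p) <= 2 ^- (4 * k).
  rewrite mulr_ge0 ?exprn_ge0 //= -[leRHS]div1r ler_pdivlMr ?exprn_gt0 //.
  by rewrite mulrAC -exprD.
have : (2 ^+ branching d * (1 - p)) ^+ m <= 2 ^- (4 * k * m).
  rewrite exprM -exprVn; case/andP: small' => ge0 le.
  by apply: lerXn2r; rewrite ?nnegrE ?invr_ge0 ?exprn_ge0.
move=> le; apply: le_trans (ler_wpM2l _ le) _; first exact: exprn_ge0.
rewrite ler_pdivrMr ?exprn_gt0 // mul1r; apply: ler_weXn2l; first by lra.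
(* [2 * n <= 4 * k * m], because [n < (m + 1) * k] and [m >= 1]; one factor [2 ^+ n] counts codes,
   the other is the decay. *)
nia.
Qed.

End Decay.

(** * Percolation near p = 1 *)

Section Crossing.
Variables (d : nat) (i0 i1 : 'I_d).
Hypothesis neq01 : i1 != i0.

Let o := origin d.

Lemma joined_line (om : config d) x i n :
  (forall j, (j < n)%N -> om (shift x i j%:Z, i)) -> joined om x (shift x i n%:Z).
Proof.
elim: n => [|n IHn] h; first by rewrite shift0; apply: joined_refl.
apply: joined_step (IHn (fun j lt => h j (ltnW lt))) _.
rewrite (_ : shift x i n.+1%:Z = head_of (shift x i n%:Z, i)).
  exact: open_adj_fwd (h n (leqnn _)).
by rewrite /head_of /= shiftD; congr (shift _ _ _); lia.
Qed.

Definition ray_edge (k : nat) : edge d := (shift o i0 k%:Z, i0).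

(** The minimum counts the edges between the [k]-th edge and the nearer end of the segment. *)
Definition radius (n k : nat) : nat := (minn k (n - k.+1)).+1.

(** Sup-distance to the base of the [k]-th ray edge, measured in the plane of the square only. *)
Definition height (k : nat) (e : edge d) : nat :=
  maxn `|(e.1 i0 - k%:Z)%R| `|e.1 i1|.

Lemma height_lip k e e' : e' \in nbrs e -> (height k e' <= (height k e).+1)%N.
Proof.
rewrite mem_nbrs => /forallP close; have := close i0; have := close i1.
rewrite /height; move: (e.1 i0) (e.1 i1) (e'.1 i0) (e'.1 i1); lia.
Qed.

(* The other route from [o] to its translate is the three-sided path over the top of
   the square of side [n] whose bottom is the ray: it is out of reach of the closed
   clusters that meet the ray, as these have diameter less than their distance to
   the two bottom corners. *)
Lemma joined_ray (om : config d) n :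
  (forall k, (k < n)%N -> ~ large_exploration om [:: ray_edge k] (radius n k)) ->
  joined om o (shift o i0 n%:Z).
Proof.
move=> nlarge.
pose K (e : edge d) := `[< exists k L, [/\ (k < n)%N, closed_list om L, saturated om L,
  {in L, forall e, (height k e < minn k (n - k.+1))%N} & e \in L] >].
pose gam e := `[< exists2 k, (k < n)%N & e = ray_edge k >].
have Kcl e : K e -> ~~ om e.
  by move=> /asboolP[k [L [_ /andP[_ /allP cl] _ _ /cl]]].
have Kadj e e' : K e -> close_edges e e' -> ~~ om e' -> K e'.
  move=> /asboolP[k [L [lt cl sat hL eL]]] ee' oe'; apply/asboolP; exists k, L; split=> //.
  by apply: sat eL _ oe'; rewrite mem_nbrs.
have gamK e : gam e -> ~~ om e -> K e.
  move=> /asboolP[k ltk ->] ce.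
  have [|L [cl sat SL szL hL]] := exploration (height_lip k) _ (nlarge k ltk).
    move=> e'; rewrite inE => /eqP ->; rewrite /height /ray_edge /= !ffunE eqxx.
    by rewrite (negbTE neq01) addr0 add0r subrr.
  apply/asboolP; exists k, L; split=> //; last by apply: SL ce; rewrite mem_head.
  by move=> e' /hL; rewrite /radius in szL; lia.
have jgam : joined gam o (shift o i0 n%:Z).
  by apply: joined_line => j ltj; apply/asboolP; exists j.
(* On the left, right and top sides the height is at least [k], [n - k] and [n]. *)
have notK (e : edge d) : (e.1 i0 = 0 \/ e.1 i0 = n%:Z \/ e.1 i1 = n%:Z) -> ~~ K e.
  move=> he; apply/asboolPn => -[k [L [ltk _ _ hL /hL]]].
  by rewrite /height; case: he => [->|[->|->]]; lia.
have jK : joined (fun e => ~~ K e) o (shift o i0 n%:Z).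
  apply: (@joined_trans _ _ _ (shift o i1 n%:Z)).
    apply: joined_line => j _; apply: notK; left.
    by rewrite /= !ffunE eq_sym (negbTE neq01) addr0.
  apply: (@joined_trans _ _ _ (shift (shift o i1 n%:Z) i0 n%:Z)).
    apply: joined_line => j _; apply: notK; right; right.
    by rewrite /= !ffunE eqxx (negbTE neq01) addr0 add0r.
  rewrite shiftC; apply/joined_sym; apply: joined_line => j _; apply: notK; right; left.
  by rewrite /= !ffunE eqxx eq_sym (negbTE neq01) addr0 add0r.
by apply: joined_sub (detour Kcl Kadj gamK jgam jK) => e /andP[].
Qed.

Section Probability.
Variables (R : realType) (p : R) (d0 : measure_display)
  (T : measurableType d0) (P : probability T R) (om : T -> config d).
Hypothesis omP : bernoulli_bond p P om.
Hypothesis p01 : 0 <= p <= 1.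
Hypothesis small : 2 ^+ (branching d + 4) * (1 - p) <= 1.

Let q : R := 2 ^+ branching d * (1 - p).

Let q_ge0 : 0 <= q.
Proof. by rewrite mulr_ge0 ?exprn_ge0 //; case/andP: p01; lra. Qed.

Let q_small : 16 * q <= 1.
Proof.
have e16 : 2 ^+ 4 = 16 :> R by rewrite -natrX.
by apply: le_trans small; rewrite exprD e16 /q mulrA [16 * _]mulrC. Qed.

Lemma sum_geometric_le n : \sum_(k < n) q ^+ k.+1 <= 2 * q.
Proof.
(* The added tail makes the induction work: it absorbs the next term because [q <= 1/2]. *)
suff : \sum_(k < n) q ^+ k.+1 + 2 * q ^+ n.+1 <= 2 * q.
  by apply: le_trans; rewrite lerDl mulr_ge0 ?exprn_ge0.
elim: n => [|n IHn]; first by rewrite big_ord0 add0r expr1.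
rewrite big_ord_recr /=; apply: le_trans IHn; rewrite -addrA lerD2l.
have : 0 <= q ^+ n.+1 by apply: exprn_ge0.
move=> z_ge0; have := ler_wpM2r z_ge0 q_small.
rewrite [q ^+ n.+2]exprS; move: (q ^+ n.+1) z_ge0 => z; move: (q) => r; lra.
Qed.

(** Union bound over the ray edges: [q ^+ radius n k <= q ^+ k.+1 + q ^+ (n - k)], and the two
    geometric sums give at most [8 * q <= 1/2]. *)
Lemma prob_joined_ray n :
  ((2^-1)%:E <= P [set t | joined (om t) o (shift o i0 n%:Z)])%E.
Proof.
pose B k := [set t | large_exploration (om t) [:: ray_edge k] (radius n k)].
have mB k : measurable (B k) by apply: measurable_large_exploration omP _ _.
have mJ := measurable_joined omP o (shift o i0 n%:Z).
have leB : (P (\big[setU/set0]_(k < n) B k) <= (2^-1)%:E)%E.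
  apply: le_trans (measure_bigsetU_le _ _ _) _ => //.
  apply: (@le_trans _ _ (\sum_(k < n) (2 * (q ^+ k.+1 + q ^+ (n - k)))%:E)%E).
    apply: lee_sum => k _; apply: le_trans (prob_large_exploration omP p01 _ _) _.
    rewrite lee_fin expr1 ler_pM2l // -/q /radius.
    rewrite -[(n - k)%N]prednK ?subn_gt0 // -subnS /minn.
    by case: ifP => _; rewrite ?lerDl ?lerDr exprn_ge0.
  rewrite sumEFin lee_fin -mulr_sumr big_split /=.
  rewrite [X in _ + X](reindex_inj rev_ord_inj) /=.
  rewrite [X in _ + X](eq_bigr (fun k : 'I_n => q ^+ k.+1)); last first.
    by move=> k _; rewrite subKn.
  have := sum_geometric_le n; have := q_small.
  by move: (\sum_(k < n) q ^+ k.+1) (q) => s r; lra.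
have sub : ~` [set t | joined (om t) o (shift o i0 n%:Z)] `<=` \big[setU/set0]_(k < n) B k.
  move=> t /= nj; rewrite -bigcup_mkord; apply: contrapT => nB; apply: nj.
  by apply: joined_ray => k ltk large; apply: nB; exists k.
have : (P (~` [set t | joined (om t) o (shift o i0 n%:Z)]) <= (2^-1)%:E)%E.
  apply: le_trans leB; apply: le_measure sub; rewrite inE //; first exact: measurableC.
  by apply: bigsetU_measurable => k _.
rewrite probability_setC //.
have : P [set t | joined (om t) o (shift o i0 n%:Z)] \is a fin_num by rewrite fin_num_measure.
by case: (P _) => // r _; rewrite -EFinB !lee_fin; lra.
Qed.

(** A cluster is finite when it lies in some finite list, and such lists are countably many. *)
Lemma measurable_percolates : measurable [set t | percolates (om t)].
Proof.
rewrite (_ : [set _ | _] = ~` \bigcup_(s : seq (vertex d)) \bigcap_(y in ~` [set` s])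
    ~` [set t | joined (om t) o y]).
  apply: measurableC; apply: countable_bigcupT_measurable; first exact: countable_count.
  move=> s; rewrite -[X in measurable X]setCK setC_bigcap; apply: measurableC.
  rewrite bigcup_mkcond; apply: countable_bigcupT_measurable.
    exact: countable_count.
  by move=> y; case: ifP => // _; rewrite setCK; apply: measurable_joined omP _ _.
apply/seteqP; split=> t /=.
  move=> inf [s _ h]; apply: inf; apply: (@sub_finite_set _ _ [set` s]) => [y jy|//].
  by apply: contrapT => ys; apply: (h y).
move=> h /finite_seqP[s sE]; apply: h; exists s => // y ys jy; apply: ys.
by rewrite -sE.
Qed.

(** By continuity from above, infinitely many ray vertices are joined to [o] with probability at
    least 1/2. *)
Lemma prob_percolates : ((2^-1)%:E <= P [set t | percolates (om t)])%E.
Proof.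
pose F n := \bigcup_(k in [set k | (n <= k)%N]) [set t | joined (om t) o (shift o i0 k%:Z)].
have mF n : measurable (F n).
  by apply: bigcup_measurable => k _; apply: measurable_joined omP _ _.
have mI : measurable (\bigcap_n F n) by apply: bigcap_measurableType.
have leF n : ((2^-1)%:E <= P (F n))%E.
  apply: le_trans (prob_joined_ray n) _; apply: le_measure; rewrite ?inE //.
    exact: measurable_joined omP _ _.
  by move=> t jt; exists n => //=.
have niF : nonincreasing_seq F.
  move=> a b le_ab; apply/subsetPset => t [k /= le_bk jt].
  by exists k => //=; apply: leq_trans le_bk.
apply: (@le_trans _ _ (P (\bigcap_n F n))).
  have F0 : (P (F 0%N) < +oo)%E by rewrite ltey_eq fin_num_measure.
  have cvF := nonincreasing_cvg_mu F0 mF mI niF.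
  rewrite -(cvg_lim _ cvF) //; apply: lime_ge; first by apply/cvg_ex; eexists; exact: cvF.
  by apply: nearW => n; apply: leF.
apply: le_measure; rewrite ?inE //; first exact: measurable_percolates.
move=> t Ft /finite_seqP[s sE].
(* A ray vertex beyond the largest [i0] coordinate in the supposedly finite cluster. *)
have [k /= lek jk] := Ft (\max_(y <- s) `|y i0|).+1 I.
have : shift o i0 k%:Z \in s by have : [set` s] (shift o i0 k%:Z) by rewrite -sE.
move=> /(@leq_bigmax_seq _ _ xpredT (fun y : vertex d => `|y i0|%N)) /(_ isT).
by rewrite ffunE /o ffunE eqxx add0r /=; lia.
Qed.

End Probability.
End Crossing.

(** * A realization of Bernoulli percolation *)

Section Realization.
Variables (R : realType) (p : R).
Hypothesis p01 : 0 < p < 1.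

Definition weight (b : bool) : R := if b then p else 1 - p.

(* The digits of [t] in the expansion obtained by repeatedly cutting an interval in
   proportions [p] and [1 - p]. *)
Fixpoint digit (n : nat) (t : R) : bool :=
  if n is n'.+1 then digit n' (if t < p then t / p else (t - p) / (1 - p)) else t < p.

Fixpoint cyl_left (a : seq bool) : R :=
  if a is b :: a' then (if b then 0 else p) + weight b * cyl_left a' else 0.

Definition cyl_width (a : seq bool) : R := \prod_(b <- a) weight b.

Lemma weight_gt0 b : 0 < weight b.
Proof. by rewrite /weight; case: b; case/andP: p01; lra. Qed.

Lemma cyl_width_gt0 a : 0 < cyl_width a.
Proof. by rewrite /cyl_width; elim/big_ind: _ => // *; [exact: mulr_gt0|exact: weight_gt0]. Qed.

Lemma cyl_bounds a : 0 <= cyl_left a /\ cyl_left a + cyl_width a <= 1.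
Proof.
rewrite /cyl_width; elim: a => [|b a [IH1 IH2]] /=; first by rewrite big_nil add0r.
rewrite big_cons; have := weight_gt0 b; case/andP: p01 => p0 p1 w0.
have : weight b * (cyl_left a + \prod_(j <- a) weight j) <= weight b * 1.
  by rewrite ler_pM2l.
have : 0 <= weight b * cyl_left a by rewrite mulr_ge0 // ltW.
by move: w0; rewrite mulrDr /weight; case: b; split; lra.
Qed.

Definition cylinder (a : seq bool) : set (measurableTypeR R) :=
  [set t | 0 <= t < 1 /\ forall i, (i < size a)%N -> digit i t = nth false a i].

(** Induction on the first digit: [f] maps each of the two pieces of the unit interval affinely onto
    the whole. *)
Lemma cylinderE a : cylinder a = `[cyl_left a, cyl_left a + cyl_width a[%classic.
Proof.
elim: a => [|b a IHa].
  apply/seteqP; split=> t /=; rewrite in_itv /= /cyl_width big_nil add0r.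
    by case.
  by split.
case/andP: p01 => p0 p1.
pose f (t : R) := if t < p then t / p else (t - p) / (1 - p).
have -> : `[cyl_left (b :: a), cyl_left (b :: a) + cyl_width (b :: a)[%classic =
    [set t | [/\ 0 <= t < 1, (t < p) = b & `[cyl_left a, cyl_left a + cyl_width a[%classic (f t)]].
  have [l0 l1] := cyl_bounds a; have w0 := cyl_width_gt0 a.
  apply/seteqP; split=> t /=; rewrite /f !in_itv /= /cyl_width big_cons -/(cyl_width a) /weight.
    case: b => /andP[le1 le2].
      have tp : t < p by nra.
      by rewrite tp ler_pdivlMr // ltr_pdivrMr //; split=> //; apply/andP; split; nra.
    have tp : (t < p) = false by apply/negbTE; rewrite -leNgt; nra.
    rewrite tp ler_pdivlMr ?ltr_pdivrMr ?subr_gt0 //.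
    by split=> //; apply/andP; split; nra.
  case=> /andP[t0 t1] <-; case: ifP => tp.
    by rewrite ler_pdivlMr // ltr_pdivrMr // => /andP[? ?]; apply/andP; split; nra.
  rewrite ler_pdivlMr ?ltr_pdivrMr ?subr_gt0 // => /andP[? ?].
  by apply/andP; split; nra.
rewrite -IHa; apply/seteqP; split=> t /=.
  move=> [t01 h]; have tb : (t < p) = b by have := h 0%N isT.
  split=> //; split; last by move=> i lti; have := h i.+1 lti.
  rewrite /f; case/andP: t01 => t0 t1; case: ifP => tp.
    by rewrite ler_pdivlMr // ltr_pdivrMr // mul0r mul1r t0 tp.
  rewrite ler_pdivlMr ?ltr_pdivrMr ?subr_gt0 // mul0r mul1r.
  by move/negbT: tp; rewrite -leNgt => tp; apply/andP; split; lra.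
by move=> [t01 tb [_ h]]; split=> // -[|i] //= lti; apply: h.
Qed.

Let PU : probability (measurableTypeR R) R := uniform_prob (@ltr01 R).

Lemma uniform_prob_sub (A : set (measurableTypeR R)) : measurable A ->
  A `<=` `[0, 1]%classic -> PU A = lebesgue_measure A.
Proof.
move=> mA sA; rewrite /PU /= /uniform_prob (eq_integral (fun=> 1%E)).
  by rewrite integral_cst //= mul1e.
move=> t; rewrite inE => /sA /=; rewrite in_itv /= /uniform_pdf => ->.
by rewrite subr0 invr1.
Qed.

Lemma measurable_cylinder a : measurable (cylinder a).
Proof. by rewrite cylinderE; apply: measurable_itv. Qed.

Lemma prob_cylinder a : PU (cylinder a) = (cyl_width a)%:E.
Proof.
have [l0 l1] := cyl_bounds a; have w0 := cyl_width_gt0 a.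
rewrite uniform_prob_sub; last 2 first.
- exact: measurable_cylinder.
- rewrite cylinderE => t /=; rewrite !in_itv /= => /andP[? ?].
  by apply/andP; split; lra.
rewrite cylinderE lebesgue_measure_itv /= lte_fin ltrDl w0.
by rewrite -EFinB; congr EFin; lra.
Qed.

Definition constraint (m : nat) (c : seq (option bool)) : set (measurableTypeR R) :=
  [set t | forall i b, nth None c i = Some b -> digit (m + i) t = b].

(** Induction on [c]: a prescribed digit extends the cylinder, while a free digit splits it in two,
    with weights [p] and [1 - p] summing to 1. *)
Lemma prob_cylinder_constraint a c :
  measurable (cylinder a `&` constraint (size a) c) /\
  PU (cylinder a `&` constraint (size a) c) =
  (cyl_width a * \prod_(b <- c) (if b is Some b' then weight b' else 1))%:E.
Proof.
elim: c a => [|b c IHc] a.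
  rewrite (_ : constraint _ _ = setT) ?setIT ?big_nil ?mulr1.
    by split; [exact: measurable_cylinder|exact: prob_cylinder].
  by apply/seteqP; split=> // t _ i b /=; rewrite nth_nil.
have split_cyl b' : cylinder (rcons a b') `&` constraint (size (rcons a b')) c =
    cylinder a `&` constraint (size a) (Some b' :: c).
  apply/seteqP; split=> t /=; rewrite /cylinder /constraint /= size_rcons.
    move=> [[t01 h] hc]; split; [split=> // i lti|move=> [|i] b'' /=].
    - by rewrite h ?leqW // nth_rcons lti.
    - by move=> [<-]; rewrite addn0 h // nth_rcons ltnn eqxx.
    - by move=> /hc; rewrite addSnnS.
  move=> [[t01 h] hc]; split; [split=> // i|move=> i b'' ci].
    rewrite ltnS leq_eqVlt nth_rcons => /orP[/eqP ->|lti]; last by rewrite lti h.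
    by rewrite ltnn eqxx -[size a]addn0; apply: hc.
  by rewrite addSnnS; apply: hc.
have cw b' : cyl_width (rcons a b') = cyl_width a * weight b'.
  by rewrite /cyl_width big_rcons.
case: b => [b|].
  by rewrite -split_cyl big_cons; have [? ->] := IHc (rcons a b); rewrite cw mulrA.
have -> : cylinder a `&` constraint (size a) (None :: c) =
    (cylinder (rcons a true) `&` constraint (size (rcons a true)) c) `|`
    (cylinder (rcons a false) `&` constraint (size (rcons a false)) c).
  rewrite !split_cyl -setIUr; congr (_ `&` _); apply/seteqP; split=> t /=.
    move=> h; case e : (digit (size a) t); [left|right] => -[|i] b /=;
      by [rewrite addn0 e => -[]|apply: (h i.+1)].
  by move=> [] h [|i] b //=; apply: (h i.+1).
have [mt pt] := IHc (rcons a true); have [mf pf] := IHc (rcons a false).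
split; first exact: measurableU.
move: mt pt mf pf; set A := _ `&` _; set B := _ `&` _ => mA pA mB pB.
have AB0 : A `&` B = set0.
  rewrite /A /B !split_cyl; apply/seteqP; split=> // t [[_ h1] [_ h2]].
  by have := h1 0%N true erefl; rewrite (h2 0%N false erefl).
have -> : PU (A `|` B) = (PU A + PU B)%E by apply: measureU.
by rewrite pA pB -EFinD !cw big_cons /weight; congr EFin; ring.
Qed.

Lemma digits_iid (J : seq nat) (b : nat -> bool) : uniq J ->
  measurable [set t : measurableTypeR R | 0 <= t < 1 /\ forall i, i \in J -> digit i t = b i] /\
  PU [set t | 0 <= t < 1 /\ forall i, i \in J -> digit i t = b i] =
  (\prod_(i <- J) weight (b i))%:E.
Proof.
move=> uJ; pose N := (\max_(i <- J) i).+1.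
have ltN i : i \in J -> (i < N)%N.
  by move=> iJ; rewrite ltnS; apply: (@leq_bigmax_seq _ _ xpredT id).
pose c := [seq if i \in J then Some (b i) else None | i <- iota 0 N].
have -> : [set t : measurableTypeR R | 0 <= t < 1 /\ forall i, i \in J -> digit i t = b i] =
    cylinder [::] `&` constraint (size (@nil bool)) c.
  apply/seteqP; split=> t /=.
    move=> [t01 h]; split; first by split.
    move=> i b'; have [ltiN|] := ltnP i N; last first.
      by move=> leN; rewrite nth_default // size_map size_iota.
    rewrite (nth_map 0%N) ?size_iota // nth_iota // !add0n.
    by case: ifP => // iJ [<-]; apply: h.
  move=> [[t01 _] h]; split=> // i iJ; apply: h.
  by rewrite (nth_map 0%N) ?size_iota ?ltN // nth_iota ?ltN // add0n iJ.
have [? ->] := prob_cylinder_constraint [::] c; split=> //.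
rewrite /cyl_width big_nil mul1r big_map; congr EFin.
rewrite (eq_bigr (fun i => if i \in J then weight (b i) else 1)); last by move=> i _; case: ifP.
rewrite -big_mkcond -big_filter; apply: perm_big; apply: uniq_perm => //.
  exact/filter_uniq/iota_uniq.
by move=> i; rewrite mem_filter mem_iota /=; apply/andP/idP => [[]//|iJ]; rewrite iJ ltN.
Qed.

(** [no_percolation] quantifies over realizations, so refuting it requires one. *)
Lemma bernoulli_bond_exists d : exists om : measurableTypeR R -> config d,
  bernoulli_bond p PU om.
Proof.
pose C := cylinder [::].
have CE (t : R) : C t <-> 0 <= t < 1 by split=> [[]|].
have mC : measurable C by apply: measurable_cylinder.
(* Edge [e] reads digit [pickle e]; off the unit interval, a null set, every edge is open. *)
pose om (t : measurableTypeR R) (e : edge d) := (0 <= t < 1) ==> digit (pickle e) t.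
have iid (F : seq (edge d)) (a : edge d -> bool) : uniq F ->
    measurable (C `&` [set t | forall e, e \in F -> om t e = a e]) /\
    PU (C `&` [set t | forall e, e \in F -> om t e = a e]) =
    (\prod_(e <- F) weight (a e))%:E.
  move=> uF; pose b i := if unpickle i is Some e then a e else false.
  have uJ : uniq (map pickle F) by rewrite map_inj_uniq //; exact: pcan_inj pickleK.
  have [mJ PJ] := digits_iid b uJ.
  have -> : C `&` [set t | forall e, e \in F -> om t e = a e] =
    [set t | 0 <= t < 1 /\ forall i, i \in map pickle F -> digit i t = b i].
    apply/seteqP; split=> t /=.
      move=> [/CE t01 h]; split=> // _ /mapP[e eF ->].
      by rewrite /b pickleK -h // /om t01.
    move=> [t01 h]; split; first exact/CE.
    by move=> e eF; rewrite /om t01 /= h ?map_f // /b pickleK.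
  split=> //; rewrite PJ big_map; congr EFin; apply: eq_bigr => e _.
  by rewrite /b pickleK.
have mom e b : measurable [set t | om t e = b].
  have [m1 _] := iid [:: e] (fun=> b) isT.
  rewrite (_ : [set t | _] = (C `&` [set t | forall e', e' \in [:: e] -> om t e' = b]) `|`
      (if b then ~` C else set0)).
    by apply: measurableU => //; case: (b) => //; apply: measurableC.
  apply/seteqP; split=> t /=.
    have [/CE Ct <-|nt] := boolP (0 <= t < 1).
      by left; split=> // e'; rewrite inE => /eqP ->.
    by rewrite /om (negbTE nt) /= => <-; right=> /= /CE; apply/negP.
  case=> [[_ ->]|] //; first by rewrite inE.
  case: b {m1} => //= nC; rewrite /om; apply/implyP => t01.
  by exfalso; apply: nC; apply/CE.
exists om; split=> [e|F a uF]; first exact: mom.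
have [mF <-] := iid F a uF.
set A := [set t | _].
have mA : measurable A.
  rewrite (_ : A = \big[setI/setT]_(e <- F) [set t | om t e = a e]).
    by apply: bigsetI_measurable.
  rewrite -bigcap_seq; apply/seteqP; split=> t /= h e; exact: h.
rewrite (measureDI PU mA mC) setIC [X in (X + _)%E](_ : _ = 0%E) ?add0e //.
apply/eqP; rewrite eq_le measure_ge0 andbT.
apply: (@le_trans _ _ (PU (~` C))).
  apply: le_measure; rewrite ?inE; [exact: measurableD|exact: measurableC|].
  by move=> t [].
by rewrite probability_setC // prob_cylinder /cyl_width big_nil subee.
Qed.

End Realization.

(** * The critical probability and the theorem *)

(** Covers [p = 1], where the digit construction would divide by [1 - p = 0]. *)
Lemma bernoulli_bond1 (R : realType) (d : nat) (d0 : measure_display)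
    (T : measurableType d0) (P : probability T R) :
  bernoulli_bond 1 P (fun _ : T => (fun=> true) : config d).
Proof.
split=> [e|F a uF].
  by rewrite (_ : [set _ | _] = setT) //; apply/seteqP; split.
have [/allP allF|/allPn[e eF nae]] := boolP (all a F).
  rewrite big_seq big1 => [|e /allF -> //]; rewrite -(probability_setT P).
  by congr (P _); apply/seteqP; split=> // t _ e /allF ->.
rewrite (big_rem e) //= (negbTE nae) subrr mul0r (_ : [set t | _] = set0) ?measure0 //.
by apply/seteqP; split=> // t /= /(_ e eF) /esym; rewrite (negbTE nae).
Qed.

Lemma p_c_le (R : realType) (d : nat) : (2 <= d)%N ->
  p_c R d <= 1 - 2 ^- (branching d + 4).
Proof.
move=> d2; have d1 := ltnW d2; rewrite /p_c; set A := [set p | _].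
have b_ge0 : 0 <= 1 - 2 ^- (branching d + 4) :> R.
  by rewrite subr_ge0 invf_le1 ?exprn_gt0 // exprn_ege1 // ler1n.
(* The supremum of the empty set is 0 by convention. *)
have [->|/set0P A0] := eqVneq A set0; first by rewrite sup0.
apply: ge_sup => // p [/andP[p0 p1] nop].
rewrite leNgt; apply/negP => ltp.
have small : 2 ^+ (branching d + 4) * (1 - p) <= 1.
  rewrite mulrC -ler_pdivlMr ?exprn_gt0 // div1r; lra.
have p01 : 0 <= p <= 1 by rewrite p0.
have neq : Ordinal d2 != Ordinal d1 by [].
have perc d0 (T : measurableType d0) (P : probability T R) (om : T -> config d) :
    bernoulli_bond p P om -> False.
  move=> omP; have := prob_percolates neq omP p01 small.
  by rewrite (nop _ _ _ _ omP) lee_fin invr_le0 lern0.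
have [p_lt1|p_ge1] := ltP p 1.
  have p_gt0 : 0 < p by apply: le_lt_trans b_ge0 ltp.
  have pp : 0 < p < 1 by rewrite p_gt0.
  by have [om /perc] := bernoulli_bond_exists pp d.
have pE : p = 1 by apply/eqP; rewrite eq_le p1.
rewrite pE in perc; apply: perc (bernoulli_bond1 d (uniform_prob (@ltr01 R))).
Qed.

Theorem theorem1p4 (R : realType) (d : nat) :
  (2 <= d)%N ->
  forall alpha : R, 0 < alpha ->
  exists p' : R, p_c R d < p' /\ p' < 1 /\
    forall p : R, p' < p <= 1 ->
    forall (d0 : measure_display) (T : measurableType d0) (P : probability T R)
      (om : T -> config d),
    bernoulli_bond p P om ->
    (* limsup_{||x||_1 -> oo} ln P(0 <-> x, D(0,x) >= (1+alpha)||x||_1) / ||x||_1 < 0 *)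
    exists c : R, 0 < c /\ exists N : nat, forall x : vertex d, (N <= norm1 x)%N ->
      (P [set t | joined (om t) (origin d) x /\
                 (((1 + alpha) * (norm1 x)%:R)%:E <= chem_dist R (om t) (origin d) x)%E]
      <= (expR (- c * (norm1 x)%:R))%:E)%E.
Proof.
move=> d2 alpha al_gt0; set b := branching d.
(* Large enough that a detour of [2 * b] per [k] steps costs at most a proportion [alpha]; the
   successor makes [k] positive. *)
pose k := (Num.bound ((2 * b)%:R / alpha)).+1.
have le_k : (2 * b)%:R <= alpha * k%:R.
  rewrite mulrC -ler_pdivrMr //; apply: ltW.
  apply: lt_le_trans (archi_boundP _) _; first by rewrite divr_ge0 // ltW.
  by rewrite ler_nat.
(* The exponent gives the smallness asked by [chem_dist_decay] and, as it exceeds [b + 4], puts [p']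
   strictly above the bound on [p_c]. *)
pose p' : R := 1 - 2 ^- (b + 4 * k + 1).
have pow_gt0 n : 0 < 2 ^+ n :> R by apply: exprn_gt0.
exists p'; split; last split.
- apply: le_lt_trans (p_c_le R d2) _; rewrite ltrD2l ltrN2 ltf_pV2 ?posrE //.
  by rewrite ltr_eXn2l ?ltr1n // -/b; lia.
- by rewrite gtrBl invr_gt0.
move=> p /andP[ltp lep1] d0 T P om omP.
exists (ln 2); split; first by rewrite ln_gt0 // ltr1n.
exists k; apply: chem_dist_decay le_k _ _ omP => //; first exact: ltnW.
- have le2 : 2 ^+ (b + 4 * k) <= 2 ^+ (b + 4 * k + 1) :> R.
    by rewrite ler_eXn2l ?ltr1n // leq_addr.
  apply: (@le_trans _ _ (2 ^+ (b + 4 * k + 1) * (1 - p))).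
    by rewrite ler_wpM2r // subr_ge0.
  rewrite mulrC -ler_pdivlMr // div1r; rewrite /p' in ltp; lra.
- rewrite lep1 andbT; apply: le_trans (ltW ltp).
  by rewrite subr_ge0 invf_le1 // exprn_ege1 // ler1n.
Qed.
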